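(* Let $M$ be a compact, smooth, connected manifold (without boundary) of dimension $\geq 4$. Let a group $G$ act smoothly and effectively on $M$ so that either: (1) a nontrivial subgroup of $G$ has a fixed point set of dimension $\geq 2$, or (2) $G$ has a subgroup $H$ whose fixed point set is $0$- or $1$-dimensional, and $H$ does not act freely and linearly on a sphere. Then for any finite integer $q\geq 2$, the set of Riemannian metrics on $M$ that are not $G$-invariant contains a set that is open and dense in the space of smooth Riemannian metrics on $M$ with respect to the $C^{q}$-topology.
   Context: Riemannian metrics are smooth. A metric is $G$-invariant if $G$ acts on $M$ by isometries of that metric. The fixed point set of a subgroup $H\subset G$ is the set of points of $M$ fixed by every element of $H$; having dimension $0$ or $1$ implies that it is nonempty. ''$H$ does not act freely and linearly on a sphere'' means that there is no action of $H$ on a unit sphere $S^{k}\subset\mathbb{R}^{k+1}$ that is the restriction of a linear (orthogonal) representation of $H$ on $\mathbb{R}^{k+1}$ and is free on $S^{k}$. *)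

(* Defs.v *)
From HB Require Import structures.
From mathcomp Require Import all_boot all_order all_algebra.
From mathcomp Require Import all_classical all_reals all_analysis.

Set Implicit Arguments.
Unset Strict Implicit.
Unset Printing Implicit Defensive.

Import Order.TTheory GRing.Theory Num.Theory.
Import numFieldNormedType.Exports.

Local Open Scope classical_set_scope.
Local Open Scope ring_scope.

(* Iterated partial derivative of f along the coordinates listed in s (the    *)
(* last one is taken first).                                                  *)
Definition partials (R : realType) (n : nat) (W : normedModType R)
    (s : seq 'I_n) (f : 'rV[R]_n -> W) : 'rV[R]_n -> W :=
  foldr (fun i h x => 'D_(delta_mx 0 i) h x) f s.

(* f is infinitely differentiable on U, which is an open set in every use     *)
(* below, so that the values of f outside U play no role.                     *)
Definition smooth_on (R : realType) (n : nat) (W : normedModType R)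
    (U : set 'rV[R]_n) (f : 'rV[R]_n -> W) : Prop :=
  forall (s : seq 'I_n) x, U x -> differentiable (partials s f) x.

(* A homeomorphism from the open set cdom onto an open subset of R^n; cmap    *)
(* and cinv are total functions, with arbitrary values off these two sets.    *)
Record chart (R : realType) (n : nat) (M : topologicalType) := Chart {
  cdom : set M;
  cmap : M -> 'rV[R]_n;
  cinv : 'rV[R]_n -> M;
  cdom_open : open cdom;
  cimg_open : open (cmap @` cdom);
  cmapK : forall p, cdom p -> cinv (cmap p) = p;
  cmap_continuous : {in cdom, continuous cmap};
  cinv_continuous : {in cmap @` cdom, continuous cinv} }.

(* The expression of f in the charts c and c', meaningful on local_dom.       *)
Definition local_rep (R : realType) (n : nat) (M : topologicalType)
    (c c' : chart R n M) (f : M -> M) : 'rV[R]_n -> 'rV[R]_n :=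
  fun x => cmap c' (f (cinv c x)).

Definition local_dom (R : realType) (n : nat) (M : topologicalType)
    (c c' : chart R n M) (f : M -> M) : set 'rV[R]_n :=
  cmap c @` (cdom c `&` f @^-1` cdom c').

(* A smooth structure without boundary, given by a (not necessarily maximal)  *)
(* smooth atlas.                                                              *)
Record smooth_atlas (R : realType) (n : nat) (M : topologicalType) :=
  SmoothAtlas {
  cindex : Type;
  charts : cindex -> chart R n M;
  charts_cover : forall p, exists i, cdom (charts i) p;
  charts_compat : forall i j,
    smooth_on (local_dom (charts i) (charts j) id)
              (local_rep (charts i) (charts j) id) }.

Arguments charts {R n M} s i.

Definition smooth_map (R : realType) (n : nat) (M : topologicalType)
    (A : smooth_atlas R n M) (f : M -> M) : Prop :=
  continuous f /\
  forall i j, smooth_on (local_dom (charts A i) (charts A j) f)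
                        (local_rep (charts A i) (charts A j) f).

(* The Jacobian matrix at p of f in the charts of indices i and j; it acts on *)
(* row vectors by right multiplication, as 'J does.                           *)
Definition chart_jacobian (R : realType) (n : nat) (M : topologicalType)
    (A : smooth_atlas R n M) (i j : cindex A) (f : M -> M) (p : M) : 'M[R]_n :=
  'J (local_rep (charts A i) (charts A j) f) (cmap (charts A i) p).

(* A metric is given by its Gram matrices: gram i p is the matrix of the      *)
(* inner product on T_pM in the coordinate basis of the chart of index i, so  *)
(* <v, w>_p = v *m gram i p *m w^T for coordinate row vectors v and w.  The   *)
(* value 0 off the chart domain is a normalization which ensures that equal   *)
(* metrics have equal gram functions.                                         *)
Record riemannian_metric (R : realType) (n : nat) (M : topologicalType)
    (A : smooth_atlas R n M) := RiemannianMetric {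
  gram : cindex A -> M -> 'M[R]_n;
  gram_out : forall i p, ~ cdom (charts A i) p -> gram i p = 0;
  gram_sym : forall i p, cdom (charts A i) p -> (gram i p)^T = gram i p;
  gram_posdef : forall i p, cdom (charts A i) p ->
    forall v : 'rV[R]_n, v != 0 -> 0 < (v *m gram i p *m v^T) 0 0;
  gram_change : forall i j p, cdom (charts A i) p -> cdom (charts A j) p ->
    gram i p = chart_jacobian i j id p *m gram j p
               *m (chart_jacobian i j id p)^T;
  gram_smooth : forall i,
    smooth_on (cmap (charts A i) @` cdom (charts A i))
              (fun x => gram i (cinv (charts A i) x)) }.

(* f^* g = g, written in charts around p and f p. *)
Definition preserves_metric (R : realType) (n : nat) (M : topologicalType)
    (A : smooth_atlas R n M) (g : riemannian_metric A) (f : M -> M) : Prop :=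
  forall i j p, cdom (charts A i) p -> cdom (charts A j) (f p) ->
    gram g i p = chart_jacobian i j f p *m gram g j (f p)
                 *m (chart_jacobian i j f p)^T.

(* The type of smooth metrics, carrying the C^q topology for the given q.     *)
Definition cq_metric (R : realType) (n : nat) (M : topologicalType)
    (A : smooth_atlas R n M) (q : nat) : Type := riemannian_metric A.

(* The metrics whose partial derivatives of order at most q, in the chart of  *)
(* index i, are e-close to those of g over K.                                 *)
Definition cq_ball (R : realType) (n : nat) (M : topologicalType)
    (A : smooth_atlas R n M) (q : nat) (g : cq_metric A q)
    (i : cindex A) (K : set M) (e : R) : set (cq_metric A q) :=
  [set h : cq_metric A q | forall (s : seq 'I_n) p, (size s <= q)%N -> K p ->
    `|partials s (fun x => gram h i (cinv (charts A i) x))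
        (cmap (charts A i) p)
      - partials s (fun x => gram g i (cinv (charts A i) x))
        (cmap (charts A i) p)| < e].

Definition cq_subbase (R : realType) (n : nat) (M : topologicalType)
    (A : smooth_atlas R n M) (q : nat) : set (set (cq_metric A q)) :=
  [set B | exists (g : cq_metric A q) (i : cindex A) (K : set M) (e : R),
    [/\ compact K, K `<=` cdom (charts A i), 0 < e & B = cq_ball g i K e]].

HB.instance Definition _ (R : realType) (n : nat) (M : topologicalType)
    (A : smooth_atlas R n M) (q : nat) :=
  gen_eqMixin (cq_metric A q).
HB.instance Definition _ (R : realType) (n : nat) (M : topologicalType)
    (A : smooth_atlas R n M) (q : nat) :=
  gen_choiceMixin (cq_metric A q).
HB.instance Definition _ (R : realType) (n : nat) (M : topologicalType)
    (A : smooth_atlas R n M) (q : nat) :=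
  @isSubBaseTopological.Build (cq_metric A q)
    (set (cq_metric A q)) (@cq_subbase R n M A q) id.

(* No topology is put on G: each element acts by a smooth map.  The inverse   *)
(* of act x is act x^-1, so these maps are diffeomorphisms.                   *)
Record smooth_action (R : realType) (n : nat) (M : topologicalType)
    (A : smooth_atlas R n M) (G : groupType) (act : G -> M -> M) : Prop := {
  act_one : forall p, act 1%g p = p;
  act_mul : forall x y p, act (x * y)%g p = act x (act y p);
  act_smooth : forall x, smooth_map A (act x) }.

Definition effective (M : Type) (G : groupType) (act : G -> M -> M) : Prop :=
  forall x, (forall p, act x p = p) -> x = 1%g.

Definition is_subgroup (G : groupType) (H : set G) : Prop :=
  group_closed (mem H).

Definition fixed_points (M : Type) (G : groupType) (act : G -> M -> M)
    (H : set G) : set M :=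
  [set p | forall x, H x -> act x p = p].

Definition invariant_metric (R : realType) (n : nat) (M : topologicalType)
    (A : smooth_atlas R n M) (G : groupType) (act : G -> M -> M)
    (g : riemannian_metric A) : Prop :=
  forall x, preserves_metric g (act x).

Definition finite_open_cover (T : topologicalType) (F : set T)
    (C : set (set T)) : Prop :=
  [/\ finite_set C, C `<=` open & F `<=` \bigcup_(U in C) U].

(* The Lebesgue covering dimension of the subspace F is at most d: every      *)
(* finite open cover of F has a finite open refinement such that each point   *)
(* of F lies in at most d + 1 of its members.  Open subsets of F are          *)
(* represented by open sets of T; only refinement and multiplicity over F     *)
(* matter.                                                                    *)
Definition covdim_le (T : topologicalType) (F : set T) (d : nat) : Prop :=
  forall C, finite_open_cover F C ->
  exists D, [/\ finite_open_cover F D,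
    forall V, D V -> exists2 U, C U & V `&` F `<=` U &
    forall p, F p -> ([set V | D V /\ V p] #<= `I_d.+1)%card].

(* dim F = d.  The empty set has dimension -1, hence none of the dimensions   *)
(* below.  For a disjoint union of submanifolds of a manifold, such as the    *)
(* fixed point set of a group of isometries, this is the largest of the       *)
(* dimensions of the components.                                              *)
Definition has_dim (T : topologicalType) (F : set T) (d : nat) : Prop :=
  covdim_le F d /\ (if d is d'.+1 then ~ covdim_le F d' else F !=set0).

(* H acts freely and linearly on the unit sphere of R^(k+1) for some k, where *)
(* H acts on column vectors through an orthogonal representation rho of H     *)
(* (the values of rho off H are irrelevant).                                  *)
Definition free_linear_on_sphere (R : realType) (G : groupType)
    (H : set G) : Prop :=
  exists (k : nat) (rho : G -> 'M[R]_k.+1),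
    [/\ forall x, H x -> (rho x)^T *m rho x = 1%:M,
        forall x y, H x -> H y -> rho (x * y)%g = rho x *m rho y &
        forall x (v : 'cV[R]_k.+1), H x -> \sum_i v i 0 ^+ 2 = 1 ->
          rho x *m v = v -> x = 1%g].

(* Main.v *)
Require Import Defs.
From HB Require Import structures.
From mathcomp Require Import all_boot all_order all_algebra.
From mathcomp Require Import all_classical all_reals all_analysis.
From mathcomp Require Import ring.
Import Order.TTheory GRing.Theory Num.Theory.
Import numFieldNormedType.Exports.
Local Open Scope classical_set_scope.
Local Open Scope ring_scope.

(** Either hypothesis on fixed point sets provides a nontrivial subgroup: in
the second case because the trivial group acts freely and linearly on every
sphere ([free_linear_trivial]).  As the action is effective, some group element
acts by a diffeomorphism f that moves a point p.  Every invariant metric is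
preserved by f, and the metrics that f does not preserve already form an open
dense set.

Openness ([open_not_preserves_metric]): where f^* g = g fails, in fixed charts an
entry of g at a point m differs from a linear combination of entries of g at f m,
and all these entries depend continuously on g.

Density ([dense_not_preserves_metric]): if f preserves g, choose a smooth bump
function b >= 0 with b p > 0 and b (f p) = 0 ([exists_bump]).  The conformal
metric (1 + t b) g agrees with g at f p but not at p, so f does not preserve it
when t > 0; and it tends to g in the C^q topology as t tends to 0
([cvg_conformal]), because on a compact part of a chart its partial derivatives
are those of g plus t times continuous functions.

The rest is calculus.  The smoothness of b in every chart requires the function
exp(-1/x), extended by 0 to x <= 0, to be smooth after composition with a smooth
function ([smooth_on_flat]).  All the functions x^(-m) exp(-1/x) are treated at
once, since the derivative of each is a combination of two others
([is_derive_flat]). *)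

Set Implicit Arguments.
Unset Strict Implicit.
Unset Printing Implicit Defensive.

(** * Differentiation rules *)

Lemma near_eq_differentiable (R : realType) (V W : normedModType R)
    (f g : V -> W) (x : V) :
  {near x, f =1 g} -> differentiable f x -> differentiable g x.
Proof.
move=> fg df.
have gexp : g \o shift x = cst (g x) + 'd f x +o_ 0 id.
  apply/eqaddoP => e e0; have /eqaddoP/(_ e e0) := diff_locally df.
  have fg0 : \forall h \near (0 : V), f (h + x) = g (h + x).
    move: (fg); rewrite (near_shift 0 x) => fg0; near=> h.
    suff : (fun z => f z = g z) ((h + (x - 0))) by rewrite subr0.
    by near: h; exact: fg0.
  rewrite -(nbhs_singleton fg) => F; near=> h.
  rewrite -[X in `|X| <= _]/(g (h + x) - (f x + 'd f x h)).
  by rewrite -(near fg0 h) //; near: h; exact: F.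
have gd := diff_unique (diff_continuous df) gexp.
by apply/diff_locallyP; rewrite gd; split => //; exact: diff_continuous.
Unshelve. all: by end_near. Qed.

(** Scalar multiplication under a name of its own, which carries the bilinear
structure that the rule for the differential of a bilinear map asks for. *)
Definition scale_op (R : realType) (W : normedModType R) (a : R) (w : W) : W :=
  a *: w.

Lemma scale_op_is_bilinear (R : realType) (W : normedModType R) :
  bilinear_for (GRing.Scale.Law.clone _ _ *:%R _)
    (GRing.Scale.Law.clone _ _ *:%R _) (@scale_op R W).
Proof.
split=> [u|u] a y z /=; first by rewrite /scale_op scalerDl scalerA.
by rewrite /scale_op scalerDr !scalerA mulrC.
Qed.

HB.instance Definition _ (R : realType) (W : normedModType R) :=
  bilinear_isBilinear.Build R R W W _ _ (@scale_op R W)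
    (scale_op_is_bilinear W).

Lemma scale_op_continuous (R : realType) (W : normedModType R) :
  continuous (fun p : R * W => scale_op p.1 p.2).
Proof. exact: scale_continuous. Qed.

Section scale.
Variables (R : realType) (V W : normedModType R) (k : V -> R) (f : V -> W).
Variables (x v : V).
Hypotheses (dk : differentiable k x) (df : differentiable f x).

Let differentiable_scale_op :
  differentiable (fun p : R * W => scale_op p.1 p.2) (k x, f x).
Proof. exact/differentiable_bilin/scale_op_continuous. Qed.

Lemma differentiable_scale : differentiable (fun y => k y *: f y) x.
Proof.
exact: (differentiable_comp (differentiable_pair dk df)
  differentiable_scale_op).
Qed.

Lemma derive_scale :
  'D_v (fun y => k y *: f y) x = k x *: 'D_v f x + 'D_v k x *: f x.
Proof.
rewrite !deriveE //; last exact: differentiable_scale.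
rewrite -[X in 'd X x]/((fun p : R * W => scale_op p.1 p.2) \o
  (fun y => (k y, f y))).
rewrite diff_comp //; last exact: differentiable_pair.
by rewrite /= diff_pair // diff_bilin //; exact: scale_op_continuous.
Qed.
End scale.

Lemma derive_comp1 (R : realType) (V : normedModType R) (h : R -> R) (l : R)
    (u : V -> R) (x v : V) :
  differentiable u x -> is_derive (u x) 1 h l ->
  'D_v (h \o u) x = 'D_v u x * l.
Proof.
move=> du [dh <-].
have dh' : differentiable h (u x) by exact/derivable1_diffP.
rewrite !deriveE //; last exact: differentiable_comp.
by rewrite diff_comp //= diff1E //= derive1E'// scale1r.
Qed.

Lemma derive_linear (R : realType) (V W W' : normedModType R)
    (L : {linear W -> W'}) (f : V -> W) (x v : V) :
  continuous L -> differentiable f x -> 'D_v (L \o f) x = L ('D_v f x).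
Proof.
move=> Lc df; have dL := linear_differentiable (f x) Lc.
rewrite !deriveE //; last exact: differentiable_comp.
by rewrite diff_comp //= diff_lin.
Qed.

(** * Iterated partial derivatives on an open set *)

Section partials_on_open.
Variables (R : realType) (n : nat) (U : set 'rV[R]_n).
Hypothesis oU : open U.
Implicit Types W : normedModType R.

Local Notation "'D_[ i ] f" := (fun x => 'D_(delta_mx 0 i) f x)
  (at level 10, i at next level, f at level 8).

Lemma open_near_eq W (f g : 'rV[R]_n -> W) x :
  (forall y, U y -> f y = g y) -> U x -> {near x, f =1 g}.
Proof.
move=> fg Ux; have : nbhs x U by apply: open_nbhs_nbhs.
by apply: filterS => y /fg.
Qed.

Lemma eq_partials W (f g : 'rV[R]_n -> W) s :
  (forall x, U x -> f x = g x) ->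
  forall x, U x -> partials s f x = partials s g x.
Proof.
move=> fg; elim: s => [|i s IHs] x Ux; first exact: fg.
by apply: near_eq_derive; exact: open_near_eq IHs Ux.
Qed.

Lemma eq_smooth_on W (f g : 'rV[R]_n -> W) :
  (forall x, U x -> f x = g x) -> smooth_on U f -> smooth_on U g.
Proof.
move=> fg sf s x Ux; apply: near_eq_differentiable (sf s x Ux).
exact: open_near_eq (eq_partials s fg) Ux.
Qed.

Lemma partialsD W (f g : 'rV[R]_n -> W) s : smooth_on U f -> smooth_on U g ->
  forall x, U x ->
    partials s (fun y => f y + g y) x = partials s f x + partials s g x.
Proof.
move=> sf sg; elim: s => [//|i s IHs] x Ux /=.
rewrite (near_eq_derive _ (open_near_eq IHs Ux)).
by rewrite -deriveD //; apply: diff_derivable; [exact: sf|exact: sg].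
Qed.

Lemma smooth_onD W (f g : 'rV[R]_n -> W) : smooth_on U f -> smooth_on U g ->
  smooth_on U (fun y => f y + g y).
Proof.
move=> sf sg s x Ux.
apply: (@near_eq_differentiable _ _ _ (partials s f + partials s g)).
  apply: open_near_eq Ux => y Uy; exact/esym/partialsD.
by apply: differentiableD; [exact: sf|exact: sg].
Qed.

(** Constant scalings and coordinate projections are both instances. *)
Lemma partials_linear W W' (L : {linear W -> W'}) (f : 'rV[R]_n -> W) s :
  continuous L -> smooth_on U f ->
  forall x, U x -> partials s (L \o f) x = L (partials s f x).
Proof.
move=> Lc sf; elim: s => [//|i s IHs] x Ux /=.
rewrite (near_eq_derive _ (open_near_eq IHs Ux)).
by apply: derive_linear => //; exact: sf.
Qed.

Lemma smooth_on_linear W W' (L : {linear W -> W'}) (f : 'rV[R]_n -> W) :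
  continuous L -> smooth_on U f -> smooth_on U (L \o f).
Proof.
move=> Lc sf s x Ux.
apply: (@near_eq_differentiable _ _ _ (L \o partials s f)).
  by apply: open_near_eq Ux => y Uy; exact/esym/partials_linear.
by apply: differentiable_comp; [exact: sf|exact: linear_differentiable].
Qed.

Lemma partials_cst W (c : W) (s : seq 'I_n) (x : 'rV[R]_n) :
  partials s (fun=> c) x = if s is [::] then c else 0.
Proof.
elim: s x => [//|i s IHs] x /=.
rewrite (_ : partials s (fun=> c) = cst (if s is [::] then c else 0)).
  by rewrite derive_cst.
by apply/funext => y; rewrite IHs.
Qed.

Lemma smooth_on_cst W (c : W) : smooth_on U (fun=> c).
Proof.
move=> s x _.
rewrite (_ : partials s (fun=> c) = cst (if s is [::] then c else 0)) //.
by apply/funext => y; rewrite partials_cst.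
Qed.

(** Smoothness peels partial derivatives off the outside of a function; this
form peels them off the inside, so that the product and chain rules can be
iterated by induction on k.  The bound k is one less than the number of
derivatives that exist. *)
Fixpoint differentiable_upto (k : nat) W (f : 'rV[R]_n -> W) : Prop :=
  (forall x, U x -> differentiable f x) /\
  if k is k'.+1 then forall i, differentiable_upto k' ('D_[i] f) else True.

Lemma smooth_on_upto W (f : 'rV[R]_n -> W) :
  smooth_on U f <-> forall k, differentiable_upto k f.
Proof.
split=> [sf k|df s].
  elim: k f sf => [|k IHk] f sf; split=> //; try exact: (sf [::]).
  move=> i; apply: IHk => s x Ux.
  by have := sf (rcons s i) x Ux; rewrite /partials foldr_rcons.
have [k] := ubnP (size s); elim: k f df s => [//|k IHk] f df s.
case/lastP: s => [_ x Ux|s i]; first by have [+ _] := df 0; apply.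
rewrite size_rcons ltnS => sk x Ux.
rewrite /partials foldr_rcons -/(partials s _); apply: (IHk) => // m.
by have [_] := df m.+1; apply.
Qed.

Lemma eq_differentiable_upto W (f g : 'rV[R]_n -> W) k :
  (forall x, U x -> f x = g x) ->
  differentiable_upto k f -> differentiable_upto k g.
Proof.
elim: k f g => [|k IHk] f g fg [df Df]; split=> //.
- by move=> x Ux; apply: near_eq_differentiable (open_near_eq fg Ux) (df x Ux).
- by move=> x Ux; apply: near_eq_differentiable (open_near_eq fg Ux) (df x Ux).
move=> i; apply: IHk (Df i) => x Ux.
by apply: near_eq_derive; exact: open_near_eq.
Qed.

Lemma differentiable_uptoW W (f : 'rV[R]_n -> W) k :
  differentiable_upto k.+1 f -> differentiable_upto k f.
Proof.
elim: k f => [|k IHk] f [df Df]; split=> // i.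
by apply: IHk; exact: Df.
Qed.

Lemma differentiable_uptoD W (f g : 'rV[R]_n -> W) k :
  differentiable_upto k f -> differentiable_upto k g ->
  differentiable_upto k (fun x => f x + g x).
Proof.
elim: k f g => [|k IHk] f g [df Df] [dg Dg]; split=> //.
- by move=> x Ux; apply: differentiableD; [exact: df|exact: dg].
- by move=> x Ux; apply: differentiableD; [exact: df|exact: dg].
move=> i; apply: eq_differentiable_upto (IHk _ _ (Df i) (Dg i)) => x Ux.
by rewrite -deriveD //; apply: diff_derivable; [exact: df|exact: dg].
Qed.

Lemma differentiable_upto_scale W (a : 'rV[R]_n -> R) (f : 'rV[R]_n -> W) k :
  differentiable_upto k a -> differentiable_upto k f ->
  differentiable_upto k (fun x => a x *: f x).
Proof.
elim: k a f => [|k IHk] a f Ha Hf; have [da Da] := Ha; have [df Df] := Hf.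
  by split=> // x Ux; apply: differentiable_scale; [exact: da|exact: df].
split=> [x Ux|i]; first by apply: differentiable_scale; [exact: da|exact: df].
apply: (@eq_differentiable_upto _
  (fun x => a x *: 'D_[i] f x + 'D_[i] a x *: f x)) => [x Ux|].
  by rewrite (derive_scale _ (da x Ux) (df x Ux)).
by apply: differentiable_uptoD; apply: IHk;
  do ?[exact: Da|exact: Df]; exact: differentiable_uptoW.
Qed.

Lemma smooth_on_scale W (a : 'rV[R]_n -> R) (f : 'rV[R]_n -> W) :
  smooth_on U a -> smooth_on U f -> smooth_on U (fun x => a x *: f x).
Proof.
move=> /smooth_on_upto sa /smooth_on_upto sf.
by apply/smooth_on_upto => k; exact: differentiable_upto_scale.
Qed.

End partials_on_open.

(** * The flat functions *)

(** The functions x^(-m) exp(-1/x), extended by 0 to x <= 0. *)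
Definition flat (R : realType) (m : nat) (x : R) : R :=
  if 0 < x then x^-1 ^+ m * expR (- x^-1) else 0.

Section flat.
Variables (R : realType).
Implicit Types (m : nat) (x : R).

Lemma flat_gt0 m x : 0 < x -> 0 < flat m x.
Proof.
by move=> x0; rewrite /flat x0 mulr_gt0 ?exprn_gt0 ?invr_gt0 ?expR_gt0.
Qed.

Lemma flat_le0 m x : x <= 0 -> flat m x = 0.
Proof. by move=> x0; rewrite /flat ltNge x0. Qed.

Lemma flat_ge0 m x : 0 <= flat m x.
Proof. by have [/flat_le0->//|/flat_gt0/ltW] := leP x 0. Qed.

(** From e^y >= y^(m+2) / (m+2)! at y = 1/x.  The square on the right is what
makes the difference quotient at 0 tend to 0. *)
Lemma flat_le_sqr m x : flat m x <= (m.+2)`!%:R * x ^+ 2.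
Proof.
have [x0|x0] := leP x 0; first by rewrite flat_le0 // mulr_ge0 ?sqr_ge0.
have y0 : 0 < x^-1 by rewrite invr_gt0.
have fact0 : (0 : R) < (m.+2)`!%:R by rewrite ltr0n fact_gt0.
rewrite /flat x0 expRN ler_pdivrMr ?expR_gt0 //.
have : x^-1 ^+ m.+2 / (m.+2)`!%:R <= expR x^-1.
  by apply: le_trans (expR_ge1Dxn m.+1 (ltW y0)); rewrite lerDr.
rewrite ler_pdivrMr // => exp_ge.
have -> : x^-1 ^+ m = x ^+ 2 * x^-1 ^+ m.+2.
  by rewrite -(addn2 m) exprD mulrC -mulrA -exprMn mulVf ?gt_eqF // expr1n mulr1.
rewrite [leRHS](_ : _ = x ^+ 2 * (expR x^-1 * (m.+2)`!%:R)); last by ring.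
by rewrite ler_pM2l ?exprn_gt0.
Qed.

(** A linear combination of two functions of the same family, which is why the
smoothness of the whole family follows by one induction. *)
Lemma is_derive_flat m x :
  is_derive x 1 (flat m) (flat m.+2 x - m%:R * flat m.+1 x).
Proof.
have [x0|x0|->] := ltgtP x 0.
- rewrite !flat_le0 ?ltW // mulr0 subr0.
  apply: (@near_eq_is_derive _ _ _ (cst 0)).
  near=> y; rewrite flat_le0 //; apply: ltW; near: y; exact: lt_nbhsl.
- apply: (@near_eq_is_derive _ _ _
    ((fun y : R => y^-1) ^+ m * (expR \o (- (fun y : R => y^-1))))).
    near=> y; have y0 : 0 < y by near: y; exact: lt_nbhsr.
    by rewrite /flat y0 !fctE.
  have dV : is_derive x 1 (fun y : R => y^-1) (- x ^- 2).
    apply: DeriveDef; first by apply: derivableV => //; rewrite gt_eqF.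
    by rewrite deriveV ?gt_eqF // derive_id scaler1.
  have dE : is_derive x 1 (expR \o (- (fun y : R => y^-1)))
      (x ^- 2 * expR (- x^-1)).
    apply: DeriveDef.
      apply/derivable1_diffP/differentiable_comp.
        by apply/derivable1_diffP; case: (is_deriveN dV).
      exact/derivable1_diffP/derivable_expR.
    rewrite (derive_comp1 (l := expR (- x^-1))).
      by case: (is_deriveN dV) => _ ->; rewrite opprK.
    by apply/derivable1_diffP; case: (is_deriveN dV).
  apply: is_derive_eq.
  rewrite /flat x0 fctE /= /GRing.scale /= -exprVn.
  by case: (m) => [|k]; rewrite ?exprS /=; ring.
(* At 0 the difference quotient is flat m h / h, of size O(h). *)
have big : forall h : R, h != 0 -> `|h^-1 * flat m h| <= (m.+2)`!%:R * `|h|.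
  move=> h h0; rewrite normrM normfV (ger0_norm (flat_ge0 _ _)).
  rewrite ler_pdivrMl ?normr_gt0 // mulrCA -expr2 real_normK ?num_real //.
  exact: flat_le_sqr.
have lim0 : (fun h : R => h^-1 *: ((flat m \o shift 0) (h *: 1) - flat m 0))
    @ 0^' --> (0 : R).
  apply/cvgr0Pnorm_lt => e e0; near=> h.
  have h0 : h != 0 by near: h; exact: nbhs_dnbhs_neq.
  rewrite /= addr0 [h *: 1]mulr1 (flat_le0 m (lexx 0)) subr0.
  apply: le_lt_trans (big h h0) _.
  rewrite mulrC -ltr_pdivlMr ?ltr0n ?fact_gt0 //.
  near: h; apply: dnbhs0_lt.
  by rewrite divr_gt0 ?ltr0n ?fact_gt0.
rewrite !flat_le0 // mulr0 subr0.
apply: DeriveDef; first by apply/cvg_ex; exists 0.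
exact: cvg_lim lim0.
Unshelve. all: by end_near. Qed.

End flat.

Section smooth_flat.
Variables (R : realType) (n : nat) (U : set 'rV[R]_n).
Hypothesis oU : open U.

Lemma differentiable_upto_flat (u : 'rV[R]_n -> R) k m :
  differentiable_upto U k u -> differentiable_upto U k (flat m \o u).
Proof.
have dflat j y : differentiable (@flat R j) y.
  by apply/derivable1_diffP; case: (is_derive_flat j y).
have dcomp j x : differentiable u x -> differentiable (flat j \o u) x.
  by move=> du; apply: differentiable_comp.
elim: k m => [|k IHk] m Hu; have [du Du] := Hu.
  by split=> // x Ux; apply: dcomp; exact: du.
split=> [x Ux|i]; first by apply: dcomp; exact: du.
apply: (@eq_differentiable_upto _ _ _ oU _ (fun x => 'D_(delta_mx 0 i) u x *:
    ((flat m.+2 \o u) x + (- m%:R : R) *: (flat m.+1 \o u) x))) => [x Ux|].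
  by rewrite (derive_comp1 _ (du x Ux) (is_derive_flat m (u x))) /= scaleNr.
have Hu' := differentiable_uptoW Hu.
apply: differentiable_upto_scale => //; first exact: Du.
apply: differentiable_uptoD => //; first exact: IHk.
apply: differentiable_upto_scale => //; last exact: IHk.
by have /smooth_on_upto := @smooth_on_cst R n U R (- m%:R); apply.
Qed.

Lemma smooth_on_flat (u : 'rV[R]_n -> R) m :
  smooth_on U u -> smooth_on U (flat m \o u).
Proof.
move=> /smooth_on_upto su.
by apply/smooth_on_upto => k; exact: differentiable_upto_flat.
Qed.

Lemma smooth_on_sum (W : normedModType R) (I : Type) (r : seq I)
    (F : I -> 'rV[R]_n -> W) :
  (forall i, smooth_on U (F i)) -> smooth_on U (fun x => \sum_(i <- r) F i x).
Proof.
move=> sF; elim: r => [|i r IHr].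
  apply: eq_smooth_on (@smooth_on_cst R n U W 0) => // x _.
  by rewrite big_nil.
apply: eq_smooth_on (smooth_onD oU (sF i) IHr) => // x _.
by rewrite big_cons.
Qed.

Lemma smooth_on_coord n' (f : 'rV[R]_n -> 'rV[R]_n') k :
  smooth_on U f -> smooth_on U (fun x => f x 0 k).
Proof.
move=> sf.
have lin : linear (fun v : 'rV[R]_n' => v 0 k) by move=> c v w; rewrite !mxE.
pose L : {linear 'rV[R]_n' -> R} :=
  HB.pack (fun v : 'rV[R]_n' => v 0 k) (GRing.isLinear.Build _ _ _ _ _ lin).
exact: (@smooth_on_linear _ _ _ oU _ _ L _ (@coord_continuous _ _ _ 0 k) sf).
Qed.

(** The argument of the bump function: positive only in a ball around a, but
smooth everywhere, unlike the distance itself. *)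
Lemma smooth_on_sqr_dist n' (f : 'rV[R]_n -> 'rV[R]_n') (a : 'rV[R]_n')
    (c : R) :
  smooth_on U f -> smooth_on U (fun x => c - \sum_k (f x 0 k - a 0 k) ^+ 2).
Proof.
move=> sf.
have sq k : smooth_on U (fun x => (f x 0 k - a 0 k) ^+ 2).
  have sd : smooth_on U (fun x => f x 0 k + - a 0 k).
    by apply: smooth_onD => //; [exact: smooth_on_coord|exact: smooth_on_cst].
  exact: smooth_on_scale.
apply: eq_smooth_on (smooth_onD oU (@smooth_on_cst R n U R c)
  (smooth_on_scale oU (@smooth_on_cst R n U R (-1)) (smooth_on_sum _ sq))) => //.
by move=> x _; rewrite scaleN1r.
Qed.
End smooth_flat.

(** * Smooth functions on a manifold and conformal metrics *)

Lemma open_chart_image (R : realType) (n : nat) (M : topologicalType)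
    (c : chart R n M) (V : set M) :
  open V -> open (cmap c @` (cdom c `&` V)).
Proof.
move=> oV; rewrite openE => _ [p [cp Vp] <-]; rewrite /interior.
have cimg : (cmap c @` cdom c) (cmap c p) by exists p.
have near_img : nbhs (cmap c p) (cmap c @` cdom c).
  by apply: open_nbhs_nbhs; split => //; exact: cimg_open.
have near_V : nbhs (cmap c p) (cinv c @^-1` V).
  apply: (cinv_continuous (mem_set cimg)).
  by rewrite cmapK //; exact: open_nbhs_nbhs.
apply: filterS (filterI near_img near_V) => _ [[m cm <-] /=].
by rewrite cmapK // => Vm; exists m.
Qed.

Definition smooth_function (R : realType) (n : nat) (M : topologicalType)
    (A : smooth_atlas R n M) (W : normedModType R) (f : M -> W) : Prop :=
  forall i, smooth_on (cmap (charts A i) @` cdom (charts A i))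
              (fun x => f (cinv (charts A i) x)).

Lemma le_mx_norm (R : realType) (n : nat) (v : 'rV[R]_n) (r : R) :
  0 <= r -> (forall k, `|v 0 k| <= r) -> `|v| <= r.
Proof.
move=> r0 vr; rewrite /Num.norm /= mx_normrE.
by apply/bigmax_leP; split => // -[i k] _ /=; rewrite ord1.
Qed.

(** In a chart around p the function is exp(-1/(r^2 - |y - a|^2)), supported in
a compact ball that avoids p'.  The image of this ball in M is closed because M
is Hausdorff, hence the extension by 0 is smooth off the chart as well. *)
Lemma exists_bump (R : realType) (n : nat) (M : topologicalType)
    (A : smooth_atlas R n M) (p p' : M) :
  hausdorff_space M -> p' <> p ->
  exists f : M -> R, [/\ smooth_function A f, forall m, 0 <= f m,
    0 < f p & f p' = 0].
Proof.
move=> hM pp'; have [i0 cp] := charts_cover A p; pose c := charts A i0.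
pose W0 := cmap c @` (cdom c `&` ~` [set p']).
have oW0 : open W0.
  apply: open_chart_image; apply: closed_openC.
  exact/accessible_closed_set1/hausdorff_accessible.
pose a := cmap c p.
have W0a : W0 a by exists p => //; split => // /esym.
have [r r0 BW0] : exists2 r : R, 0 < r & [set y | `|a - y| <= r] `<=` W0.
  have /nbhs_closedballP[r rW0] : nbhs a W0 by exact: open_nbhs_nbhs.
  exists r%:num => // y /= ay; apply: rW0.
  by rewrite closed_ballE.
pose B := [set y | `|a - y| <= r].
have cB : compact B.
  apply: bounded_closed_compact; last exact: closed_closed_ball_.
  exists (`|a| + r); split; first exact: num_real.
  move=> x rx y /= ay; apply: le_trans (ltW rx).
  rewrite -[y](subKr a); apply: le_trans (ler_normB _ _) _.
  by rewrite lerD2l.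
have cK : closed (cinv c @` B).
  apply: compact_closed => //; apply: continuous_compact => //.
  apply: continuous_in_subspaceT => y /set_mem /BW0[m [cm _] <-].
  by apply: cinv_continuous; apply/mem_set; exists m.
pose u (y : 'rV[R]_n) := r ^+ 2 - \sum_k (y 0 k - a 0 k) ^+ 2.
(* B is a ball for the sup norm, so it contains the Euclidean ball. *)
have uB y : 0 < u y -> B y.
  rewrite /u subr_gt0 => sum_lt; apply: le_mx_norm => [|k]; first exact: ltW.
  rewrite !mxE distrC -(ler_pXn2r (n := 2)) ?nnegrE ?(ltW r0) //.
  rewrite real_normK ?num_real //; apply: le_trans (ltW sum_lt).
  rewrite (bigD1 k) //= lerDl; apply: sumr_ge0 => j _; exact: sqr_ge0.
pose f m := if `[< cdom c m >] then flat 0 (u (cmap c m)) else 0.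
have f0 m : ~ (cdom c m /\ B (cmap c m)) -> f m = 0.
  rewrite /f; case: asboolP => // cm nB.
  apply: flat_le0; rewrite leNgt; apply/negP => /uB Bm; exact: nB.
exists f; split.
- move=> i s _ [m im <-].
  (* Either near m the bump is the flat function of a smooth expression in the
     transition map, or m lies off the support and the bump vanishes near m. *)
  have [cm|ncm] := pselect (cdom c m).
    have oU : open (cmap (charts A i) @` (cdom (charts A i) `&` cdom c)).
      by apply: open_chart_image; exact: cdom_open.
    have smU := smooth_on_flat oU 0
      (smooth_on_sqr_dist oU a (r ^+ 2) (@charts_compat _ _ _ A i i0)).
    apply: (eq_smooth_on oU _ smU) => [_ [m' [im' cm'] <-]|]; last by exists m.
    by rewrite /f /local_rep /= cmapK // asboolT.
  have oU : open (cmap (charts A i) @`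
      (cdom (charts A i) `&` ~` (cinv c @` B))).
    by apply: open_chart_image; exact: closed_openC.
  apply: (eq_smooth_on oU _ (@smooth_on_cst R n _ R 0)).
    move=> _ [m' [im' Km'] <-]; rewrite cmapK // f0 // => -[cm' Bm'].
    by apply: Km'; exists (cmap c m') => //; rewrite cmapK.
  exists m => //; split => // -[y /BW0[m' [cm' _] <-]].
  by rewrite cmapK // => m'm; apply: ncm; rewrite -m'm.
- by move=> m; rewrite /f; case: asboolP => // _; exact: flat_ge0.
- rewrite /f asboolT //; apply: flat_gt0; rewrite /u big1 => [|k _].
    by rewrite subr0 exprn_gt0.
  by rewrite subrr expr0n.
- apply: f0 => -[cp' /BW0[m [cm mp'] mE]]; apply: mp' => /=.
  by rewrite -(cmapK cm) mE cmapK.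
Qed.

Section conformal.
Variables (R : realType) (n : nat) (M : topologicalType).
Variables (A : smooth_atlas R n M) (g : riemannian_metric A) (u : M -> R).
Hypotheses (u_gt0 : forall p, 0 < u p) (u_smooth : smooth_function A u).

Let G i p := u p *: gram g i p.

Lemma conformal_out i p : ~ cdom (charts A i) p -> G i p = 0.
Proof. by move=> ip; rewrite /G gram_out // scaler0. Qed.

Lemma conformal_sym i p : cdom (charts A i) p -> (G i p)^T = G i p.
Proof. by move=> ip; rewrite /G linearZ /= gram_sym. Qed.

Lemma conformal_posdef i p : cdom (charts A i) p ->
  forall v : 'rV[R]_n, v != 0 -> 0 < (v *m G i p *m v^T) 0 0.
Proof.
move=> ip v v0; rewrite /G -scalemxAr -scalemxAl mxE.
by rewrite mulr_gt0 // gram_posdef.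
Qed.

Lemma conformal_change i j p :
  cdom (charts A i) p -> cdom (charts A j) p ->
  G i p = chart_jacobian i j id p *m G j p *m (chart_jacobian i j id p)^T.
Proof.
by move=> ip jp; rewrite /G (gram_change g ip jp) -scalemxAr -scalemxAl.
Qed.

Lemma conformal_smooth i :
  smooth_on (cmap (charts A i) @` cdom (charts A i))
    (fun x => G i (cinv (charts A i) x)).
Proof.
apply: smooth_on_scale; [exact: cimg_open|exact: u_smooth|exact: gram_smooth].
Qed.

Definition conformal : riemannian_metric A :=
  RiemannianMetric conformal_out conformal_sym conformal_posdef
    conformal_change conformal_smooth.

End conformal.

(** * The C^q topology *)

Section cq_topology.
Variables (R : realType) (n : nat) (M : topologicalType).
Variables (A : smooth_atlas R n M) (q : nat).
Implicit Types (g h : cq_metric A q) (B : set (cq_metric A q)).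

Lemma open_cq_subbase B : cq_subbase B -> open B.
Proof.
move=> sB; exists [set B]; last by rewrite bigcup_set1.
by move=> _ ->; exact: finI_from1.
Qed.

Lemma cvg_cq_metric (F : set_system (cq_metric A q)) g : Filter F ->
  (forall B, cq_subbase B -> B g -> F B) -> F --> g.
Proof.
move=> FF FB O; rewrite nbhsE => -[V [[D' D'sub <-] D'g] VO].
apply: filterS VO _; case: D'g => _ /[dup] /D'sub [D Dsub <-].
set C := (X in D' X) => D'C Cg.
have FC : F C.
  apply: filter_bigI => B BD; apply: FB; last exact: Cg.
  by apply: set_mem; exact: Dsub.
by apply: filterS FC => h Ch; exists C.
Qed.

Lemma continuous_partials_chart (W : normedModType R) (c : chart R n M)
    (F : 'rV[R]_n -> W) s p :
  smooth_on (cmap c @` cdom c) F -> cdom c p ->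
  {for p, continuous (fun m => partials s F (cmap c m))}.
Proof.
move=> sF cp; apply: (@continuous_comp _ _ _ (cmap c) (partials s F)).
  by apply: cmap_continuous; exact: mem_set.
by apply/differentiable_continuous/sF; exists p.
Qed.

(** There are finitely many multi-indices of length at most q. *)
Lemma near_seq_le (T : Type) (F : set_system T) (P : T -> seq 'I_n -> Prop) :
  Filter F -> (forall s, (size s <= q)%N -> \forall t \near F, P t s) ->
  \forall t \near F, forall s, (size s <= q)%N -> P t s.
Proof.
move=> FF FP.
have : \forall t \near F, forall (k : 'I_q.+1) (s : k.-tuple 'I_n), P t s.
  apply: filter_forall => k; apply: filter_forall => s.
  by apply: FP; rewrite size_tuple -ltnS.
apply: filterS => t Pt s sq.
exact: (Pt (Ordinal (sq : (size s < q.+1)%N)) (in_tuple s)).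
Qed.

(** A subbasic set around g need not be centred at g: it bounds strictly, over
a compact set K, the distance from the derivatives of g to those of another metric.
The bound persists near each point of K for all large k, and compactness of K
makes this uniform. *)
Lemma cvg_conformal g (f : M -> R) (h : nat -> cq_metric A q) :
  smooth_function A f ->
  (forall k i p, gram (h k) i p = (1 + harmonic k * f p) *: gram g i p) ->
  h @ \oo --> g.
Proof.
move=> sf hE; apply: cvg_cq_metric.
move=> _ [g0 [i [K [e [cK Kc e0 ->]]]]] gB.
pose c := charts A i; pose U := cmap c @` cdom c.
have oU : open U by exact: cimg_open.
pose G x := gram g i (cinv c x); pose fG x := f (cinv c x) *: G x.
have sG : smooth_on U G by exact: gram_smooth.
have sfG : smooth_on U fG by apply: smooth_on_scale => //; exact: sf.
have hG k s x : U x ->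
    partials s (fun x => gram (h k) i (cinv c x)) x =
    partials s G x + harmonic k *: partials s fG x.
  move=> Ux; rewrite (@eq_partials _ _ _ oU _ _
    (fun y => G y + ( *:%R (harmonic k) \o fG) y)) => [|y _|//]; last first.
    by rewrite /G /fG /= hE scalerDl scale1r scalerA.
  have Lc : continuous ( *:%R (harmonic k) : 'M[R]_n -> 'M[R]_n).
    exact: scaler_continuous.
  rewrite (partialsD oU) //; last exact: smooth_on_linear.
  by rewrite (partials_linear oU).
suff : \forall k \near \oo, forall s, (size s <= q)%N -> forall p, K p ->
    `|partials s G (cmap c p) + harmonic k *: partials s fG (cmap c p)
      - partials s (fun x => gram g0 i (cinv c x)) (cmap c p)| < e.
  apply: filterS => k kP s p sq Kp.
  by rewrite hG; [exact: kP|exists p => //; exact: Kc].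
apply: near_seq_le => s sq.
apply: (@iffLR _ _ (compact_near_coveringP K) cK nat \oo) => p Kp.
pose G0 x := gram g0 i (cinv c x).
have cvg_partials (W : normedModType R) (H : 'rV[R]_n -> W) : smooth_on U H ->
    (fun z : M * nat => partials s H (cmap c z.1))
      @ filter_prod (nbhs p) \oo --> partials s H (cmap c p).
  move=> sH; apply: (@cvg_comp _ _ _ fst (fun m => partials s H (cmap c m))).
    exact: cvg_fst.
  exact: (continuous_partials_chart sH (Kc p Kp)).
have sG0 : smooth_on U G0 by exact: gram_smooth.
have cvg_all : (fun z : M * nat => partials s G (cmap c z.1)
      + harmonic z.2 *: partials s fG (cmap c z.1) - partials s G0 (cmap c z.1))
    @ filter_prod (nbhs p) \oo -->
    partials s G (cmap c p) + 0 *: partials s fG (cmap c p)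
      - partials s G0 (cmap c p).
  apply: cvgB; last exact: cvg_partials.
  apply: cvgD; first exact: cvg_partials.
  apply: cvgZ; last exact: cvg_partials.
  apply: (@cvg_comp _ _ _ snd harmonic); first exact: cvg_snd.
  exact: cvg_harmonic.
have lim_lt : `|partials s G (cmap c p) + 0 *: partials s fG (cmap c p)
      - partials s G0 (cmap c p)| < e.
  by rewrite scale0r addr0; exact: gB.
exact: (cvgr_lt _ (cvg_norm cvg_all) e lim_lt).
Qed.
End cq_topology.

(** * Metrics that a map does not preserve *)

Section matrix_limits.
Variables (R : realType) (m n : nat) (T : Type) (F : set_system T).
Hypothesis FF : Filter F.

Lemma cvg_sum_R (I : Type) (r : seq I) (f : I -> T -> R) (l : I -> R) :
  (forall i, f i t @[t --> F] --> l i) ->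
  \sum_(i <- r) f i t @[t --> F] --> \sum_(i <- r) l i.
Proof. by move=> fl; apply: cvg_big => //; exact: add_continuous. Qed.

Lemma cvg_entry (X : T -> 'M[R]_(m, n)) (Y : 'M[R]_(m, n)) i j :
  X t @[t --> F] --> Y -> X t i j @[t --> F] --> Y i j.
Proof.
move=> XY; apply: (@cvg_comp _ _ _ X (fun Z : 'M[R]_(m, n) => Z i j)).
  exact: XY.
exact: coord_continuous.
Qed.
End matrix_limits.

Lemma cvg_congruence_entry (R : realType) (n : nat) (T : Type)
    (F : set_system T) (FF : Filter F)
    (X : T -> 'M[R]_n) (Y J : 'M[R]_n) a b :
  X t @[t --> F] --> Y ->
  (J *m X t *m J^T) a b @[t --> F] --> (J *m Y *m J^T) a b.
Proof.
move=> XY.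
have congE Z : (J *m Z *m J^T) a b = \sum_l (\sum_k J a k * Z k l) * J^T l b.
  by rewrite mxE; apply: eq_bigr => l _; rewrite mxE.
rewrite congE; under eq_fun do rewrite congE.
apply: cvg_sum_R => l; apply: cvgM; last exact: cvg_cst.
apply: cvg_sum_R => k; apply: cvgM; first exact: cvg_cst.
exact: cvg_entry.
Qed.

Lemma cvg_gram (R : realType) (n : nat) (M : topologicalType)
    (A : smooth_atlas R n M) (q : nat) (F : set_system (cq_metric A q))
    (FF : Filter F) (g : cq_metric A q) i p :
  F --> g -> cdom (charts A i) p -> gram h i p @[h --> F] --> gram g i p.
Proof.
move=> Fg ip; apply/cvgrPdist_lt => e e0.
pose B := cq_ball g i [set p] e.
have sB : cq_subbase B.
  exists g, i, [set p], e; split => //; first exact: compact_set1.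
  by move=> _ ->.
have Bg : B g by move=> s m _ _; rewrite subrr normr0.
have nB : nbhs g B by apply: open_nbhs_nbhs; split => //; exact: open_cq_subbase.
apply: filterS (Fg _ nB) => h /(_ [::] p isT erefl) /=.
by rewrite cmapK // distrC.
Qed.

(** A failure of f^* g = g is visible in a single entry at a single point, and
entries of the Gram matrices are continuous in g even for C^0 closeness. *)
Lemma open_not_preserves_metric (R : realType) (n : nat) (M : topologicalType)
    (A : smooth_atlas R n M) (q : nat) (f : M -> M) :
  open [set g : cq_metric A q | ~ preserves_metric g f].
Proof.
rewrite openE => g ng; rewrite /interior /=.
have [i [j [p [ip jfp gne]]]] : exists i j p, [/\ cdom (charts A i) p,
    cdom (charts A j) (f p) & gram g i p <> chart_jacobian i j f p
      *m gram g j (f p) *m (chart_jacobian i j f p)^T].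
  apply: contrapT => nex; apply: ng => i j p ip jfp.
  by apply: contrapT => ne; apply: nex; exists i, j, p.
set J := chart_jacobian i j f p in gne.
have [a [b ab_ne]] : exists a b,
    gram g i p a b - (J *m gram g j (f p) *m J^T) a b != 0.
  apply: contrapT => nex; apply: gne; apply/matrixP => a b.
  by apply: contrapT => /eqP ne; apply: nex; exists a, b; rewrite subr_eq0.
have FF : Filter (nbhs g) by exact: nbhs_filter.
have gramE k r : cdom (charts A k) r ->
    gram h k r @[h --> nbhs g] --> gram g k r by exact: cvg_gram.
have lim : (gram h i p a b - (J *m gram h j (f p) *m J^T) a b)
    @[h --> nbhs g] -->
    gram g i p a b - (J *m gram g j (f p) *m J^T) a b.
  apply: cvgB; first by apply: cvg_entry; exact: gramE.
  by apply: cvg_congruence_entry; exact: gramE.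
apply: filterS (cvgr_neq0 _ lim ab_ne) => h h_ne hf.
by move: h_ne; rewrite (hf i j p ip jfp) subrr eqxx.
Qed.

(** The hypothesis 0 < n excludes manifolds of dimension 0, whose only metric is
preserved by every map. *)
Lemma dense_not_preserves_metric (R : realType) (n : nat) (M : topologicalType)
    (A : smooth_atlas R n M) (q : nat) (f : M -> M) (p : M) :
  (0 < n)%N -> hausdorff_space M -> f p <> p ->
  dense [set g : cq_metric A q | ~ preserves_metric g f].
Proof.
move=> n0 hM fp O [g Og] oO.
have [gf|] := pselect (preserves_metric g f); last by exists g.
have [b [sb b0 bp bfp]] := exists_bump A hM fp.
have u_gt0 k m : 0 < 1 + @harmonic R k * b m.
  by rewrite ltr_pwDl // mulr_ge0 // harmonic_ge0.
have su k : smooth_function A (fun m => 1 + @harmonic R k * b m).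
  move=> i; have oU := @cimg_open _ _ _ (charts A i).
  apply: smooth_onD => //; first exact: smooth_on_cst.
  exact: (smooth_on_scale oU (@smooth_on_cst R n _ R (harmonic k)) (sb i)).
pose h k : cq_metric A q := conformal g (u_gt0 k) (su k).
have hg : h @ \oo --> (g : cq_metric A q) by exact: (cvg_conformal sb).
have /hg [k _ /(_ k (leqnn k)) Ohk] : nbhs (g : cq_metric A q) O.
  exact: open_nbhs_nbhs.
exists (h k); split => // hf.
have [i ip] := charts_cover A p; have [j jfp] := charts_cover A (f p).
(* At f p the factor is 1, so invariance of both metrics would force the Gram
   matrix of g at p to be multiplied by 1 + b p / (k + 1) and stay the same. *)
have := hf i j p ip jfp; rewrite /= bfp mulr0 addr0 scale1r.
rewrite -gf // => /eqP; rewrite -subr_eq0 -{2}[gram g i p]scale1r -scalerBl.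
rewrite addrAC subrr add0r scaler_eq0 gt_eqF ?mulr_gt0 ?harmonic_gt0 //=.
apply/negP; apply/eqP => gip0.
have v0 : const_mx 1 != 0 :> 'rV[R]_n.
  apply/eqP => /matrixP/(_ 0 (Ordinal n0)); rewrite !mxE => /eqP.
  by rewrite oner_eq0.
by have := gram_posdef g ip v0; rewrite gip0 mulmx0 mul0mx mxE ltxx.
Qed.

(** * The group action *)

Lemma free_linear_trivial (R : realType) (G : groupType) :
  free_linear_on_sphere R [set 1%g : G].
Proof.
exists 0, (fun=> 1%:M); split => [x _|x y _ _|x v ->//].
  by rewrite trmx1 mulmx1.
by rewrite mulmx1.
Qed.

Lemma subgroup_neq1 (G : groupType) (H : set G) :
  is_subgroup H -> H <> [set 1%g] -> exists2 x, H x & x <> 1%g.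
Proof.
move=> [H1 _] Hne; apply: contrapT => nex; apply: Hne.
apply/seteqP; split => [x Hx|_ ->]; last exact/set_mem.
by apply: contrapT => x1; apply: nex; exists x.
Qed.

Unset Implicit Arguments.
Set Strict Implicit.
Theorem corollaryB (R : realType) (n : nat) (M : topologicalType)
    (A : smooth_atlas R n M) (G : groupType) (act : G -> M -> M)
    (hM_hausdorff : hausdorff_space M) (hM_countable : @second_countable M)
    (hM_compact : compact [set: M]) (hM_connected : connected [set: M])
    (hn : (4 <= n)%N)
    (h_smooth : smooth_action A act) (h_effective : effective act)
    (h_fix :
      (exists H : set G, [/\ is_subgroup H, H <> [set 1%g] &
         exists2 d : nat, (2 <= d)%N & has_dim (fixed_points act H) d])
      \/
      (exists H : set G, [/\ is_subgroup H,
         has_dim (fixed_points act H) 0 \/ has_dim (fixed_points act H) 1 &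
         ~ free_linear_on_sphere R H]))
    (q : nat) (hq : (2 <= q)%N) :
  exists O : set (cq_metric A q),
    [/\ open O, dense O &
        O `<=` [set g : cq_metric A q | ~ invariant_metric act g]].
Proof.
have [H [subH ntH]] : exists H : set G, is_subgroup H /\ H <> [set 1%g].
  case: h_fix => [[H [subH ntH _]]|[H [subH _ nfree]]]; exists H => //.
  by split=> // H1; apply: nfree; rewrite H1; exact: free_linear_trivial.
have [x _ x1] := subgroup_neq1 subH ntH.
have [p xp] : exists p, act x p <> p.
  apply: contrapT => nex; apply: x1; apply: h_effective => p.
  by apply: contrapT => xp; apply: nex; exists p.
exists [set g : cq_metric A q | ~ preserves_metric g (act x)]; split.
- exact: open_not_preserves_metric.
- by apply: dense_not_preserves_metric xp => //; exact: leq_trans hn.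
- by move=> g gx ginv; apply: gx; exact: ginv.
Qed.
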